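(* Let $n\ge 2$ and let $\beta_{i1},\beta_{i2},\beta_{i3}$ ($i=2,\dots,n$) be arbitrary positive real numbers. In both the ring-road and the open-road cases, the mixed traffic system $\dot x(t)=Ax(t)+Bu(t)$, $y(t)=Cx(t)$, whose output contains the states of vehicle 1, is detectable, i.e. the pair $(A,C)$ is detectable, even if only the states of vehicle 1 are directly observed, i.e. even if $C=\begin{bmatrix}e_1&e_2\end{bmatrix}^T\in\mathbb{R}^{2\times 2n}$.
   Context: Mixed traffic system with $n\ge 2$ vehicles (vehicle 1 is the automated vehicle (CAV), vehicles $2,\dots,n$ are human-driven), state $x\in\mathbb{R}^{2n}$, partitioned into blocks of size 2. The matrix $A\in\mathbb{R}^{2n\times 2n}$, viewed as an $n\times n$ array of $2\times2$ blocks, has the following block contributions, all other blocks being zero: block $(1,1)$ contains $J_1=\begin{bmatrix}0&-1\\0&0\end{bmatrix}$; block $(1,n)$ contains $J_2$; and for $i=2,\dots,n$, block $(i,i-1)$ is $A_{i1}=\begin{bmatrix}0&1\\0&\beta_{i3}\end{bmatrix}$ and block $(i,i)$ is $A_{i2}=\begin{bmatrix}0&-1\\ \beta_{i1}&-\beta_{i2}\end{bmatrix}$. The standing assumption is $\beta_{i1}>0,\ \beta_{i2}>0,\ \beta_{i3}>0$ for $i=2,\dots,n$. Ring-road case: $J_2=\begin{bmatrix}0&1\\0&0\end{bmatrix}$, $B=e_2\in\mathbb{R}^{2n\times1}$. Open-road case: $J_2=0_{2\times2}$, $B=[e_1\ e_2]\in\mathbb{R}^{2n\times 2}$. (The matrix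 $B$ plays no role in detectability.) The output matrix is $C\in\mathbb{R}^{2m\times2n}$ with $C^T=\begin{bmatrix}e_{2j_1-1}&e_{2j_1}&\cdots&e_{2j_m-1}&e_{2j_m}\end{bmatrix}$, where $j_1,\dots,j_m$ are the indices of the vehicles whose states are measured, with $j_1=1$; here $e_j$ is the $j$-th column of the identity matrix. Observing only vehicle 1 corresponds to $m=1$. The pair $(A,C)$ is detectable if its unobservable modes are all stable, i.e. every eigenvalue $\lambda\in\mathbb{C}$ of $A$ for which there is a nonzero $\rho\in\mathbb{C}^{2n}$ with $A\rho=\lambda\rho$ and $C\rho=0$ satisfies $\mathrm{Re}(\lambda)<0$. *)

(* Defs.v *)
From mathcomp Require Import all_boot all_order all_algebra.
From mathcomp Require Import reals.
From mathcomp Require Import complex.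

Set Implicit Arguments.
Unset Strict Implicit.
Unset Printing Implicit Defensive.

Import GRing.Theory.
Local Open Scope ring_scope.

(* Linear time-invariant system x' = A x + B u, y = C x, with N states,
   p inputs and q outputs. *)
Record lti_system (R : realType) (N p q : nat) := LTISystem {
  state_mx : 'M[R]_N;
  input_mx : 'M[R]_(N, p);
  output_mx : 'M[R]_(q, N)
}.

Definition unobservable_mode (R : realType) (N q : nat)
    (A : 'M[R]_N) (C : 'M[R]_(q, N)) (lambda : R[i]) : Prop :=
  exists rho : 'cV[R[i]]_N,
    [/\ rho != 0,
        map_mx (real_complex R) A *m rho = lambda *: rho &
        map_mx (real_complex R) C *m rho = 0].

Definition detectable_pair (R : realType) (N q : nat)
    (A : 'M[R]_N) (C : 'M[R]_(q, N)) : Prop :=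
  forall lambda : R[i], unobservable_mode A C lambda -> complex.Re lambda < 0.

Definition detectable (R : realType) (N p q : nat)
    (S : lti_system R N p q) : Prop :=
  detectable_pair (state_mx S) (output_mx S).

(* All indices are 0-based: vehicle i : 'I_n is vehicle i + 1 of the usual
   numbering, so the automated vehicle is the one of index 0.  Entry
   2 * i + c of the state is component c of vehicle i. *)
Fact state_index_subproof (n : nat) (i : 'I_n) (c : 'I_2) :
  (2 * i + c < 2 * n)%N.
Proof.
apply: (@leq_trans (2 * i.+1)%N); last by rewrite leq_mul2l ltn_ord.
by rewrite mulnS addnC ltn_add2r ltn_ord.
Qed.
Definition state_index (n : nat) (i : 'I_n) (c : 'I_2) : 'I_(2 * n) :=
  Ordinal (state_index_subproof i c).

Fact block_index_subproof (n : nat) (k : 'I_(2 * n)) : (k %/ 2 < n)%N.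
Proof. by rewrite ltn_divLR // [(n * 2)%N]mulnC. Qed.
Definition block_index (n : nat) (k : 'I_(2 * n)) : 'I_n :=
  Ordinal (block_index_subproof k).

Fact entry_index_subproof (n : nat) (k : 'I_(2 * n)) : (k %% 2 < 2)%N.
Proof. by rewrite ltn_mod. Qed.
Definition entry_index (n : nat) (k : 'I_(2 * n)) : 'I_2 :=
  Ordinal (entry_index_subproof k).

(* The matrix with rows (a, b) and (c, d). *)
Definition mx22 (R : realType) (a b c d : R) : 'M[R]_2 :=
  \matrix_(i, j) if i == 0 then (if j == 0 then a else b)
                 else (if j == 0 then c else d).

Inductive road := Ring | Open.

Section TrafficSystem.
Variables (R : realType) (r : road) (n : nat).

Definition J1 : 'M[R]_2 := mx22 0 (-1) 0 0.

Definition J2 : 'M[R]_2 :=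
  match r with Ring => mx22 0 1 0 0 | Open => 0 end.

(* beta1 i, beta2 i, beta3 i are used only for human-driven vehicles,
   i.e. for 0 < i. *)
Variables beta1 beta2 beta3 : 'I_n -> R.

Definition A1 (i : 'I_n) : 'M[R]_2 := mx22 0 1 0 (beta3 i).

Definition A2 (i : 'I_n) : 'M[R]_2 := mx22 0 (-1) (beta1 i) (- beta2 i).

Definition traffic_block (i k : 'I_n) : 'M[R]_2 :=
  if i == 0%N :> nat then
    (if k == 0%N :> nat then J1 else 0) + (if k == n.-1 :> nat then J2 else 0)
  else
    (if k == i.-1 :> nat then A1 i else 0) + (if k == i then A2 i else 0).

Definition traffic_A : 'M[R]_(2 * n) :=
  \matrix_(p, q) traffic_block (block_index p) (block_index q)
                              (entry_index p) (entry_index q).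

Definition n_inputs : nat := match r with Ring => 1 | Open => 2 end.

(* e_2 on the ring road, [e_1 e_2] on the open road. *)
Definition traffic_B : 'M[R]_(2 * n, n_inputs) :=
  \matrix_(p, c) match r with
                 | Ring => (p == 1%N :> nat)%:R
                 | Open => (p == c :> nat)%:R
                 end.

(* The rows of C are the unit vectors of the two coordinates of vehicles
   j 0, j 1, ..., j (m - 1). *)
Definition measure_C (m : nat) (j : 'I_m -> 'I_n) : 'M[R]_(2 * m, 2 * n) :=
  \matrix_(k < 2 * m)
    delta_mx 0 (state_index (j (block_index k)) (entry_index k)).

(* [e_1 e_2]^T *)
Definition measure_first_C : 'M[R]_(2, 2 * n) :=
  \matrix_(c, p) (p == c :> nat)%:R.

Definition traffic_system (q : nat) (C : 'M[R]_(q, 2 * n)) :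
    lti_system R (2 * n) n_inputs q :=
  LTISystem traffic_A traffic_B C.

End TrafficSystem.

(* Main.v *)
Require Import Defs.
From mathcomp Require Import all_boot all_order all_algebra.
From mathcomp Require Import reals.
From mathcomp Require Import complex.
From mathcomp Require Import ring lra.

(** Suppose that [A *m rho = lambda *: rho] with [rho] vanishing on the automated
    vehicle.  Write [(s i, v i)] for the two coordinates of [rho] at vehicle
    [i].  The rows of a human-driven vehicle [i] couple it to its predecessor
    only through the velocity [v (i - 1)]; with [b1, b2, b3] its parameters,
      [lambda * s i = v (i - 1) - v i],
      [lambda * v i = b3 * v (i - 1) + b1 * s i - b2 * v i].
    If [v (i - 1) = 0], eliminating [v i] leaves
      [(lambda ^+ 2 + b2 * lambda + b1) * s i = 0],
    and a monic quadratic with positive coefficients has no root in the closed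
    right half-plane ([hurwitz_quadratic]).  So if [0 <= Re lambda], the zero
    travels down the platoon from vehicle to vehicle, and [rho = 0].

    Only the rows of the human-driven vehicles enter, and these are the same on
    the ring road and on the open road; of the output, only that it determines
    the state of the automated vehicle.  One argument
    ([detectable_first_measured]) therefore covers all cases. *)

Local Open Scope ring_scope.
Import Order.TTheory GRing.Theory Num.Theory.

(** The imaginary part of the value at [x + i y] is [y * (2 x + b)], whose
    second factor is positive; so a root there would be real and nonnegative,
    where the value is at least [c]. *)
Lemma hurwitz_quadratic (R : realType) (b c : R) (z : R[i]%C) :
  0 < b -> 0 < c -> 0 <= complex.Re z ->
  z ^+ 2 + real_complex R b * z + real_complex R c != 0.
Proof.
case: z => x y b_gt0 c_gt0 /= x_ge0.
apply/negP; rewrite expr2 eq_complex /= => /andP[/eqP eq_re /eqP eq_im].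
have /eqP : y * (2 * x + b) = 0 by rewrite -[RHS]eq_im; ring.
rewrite mulf_eq0 => /orP[] /eqP h; last by lra.
by move: eq_re; rewrite h; nra.
Qed.

(** * The block structure of the state *)

Lemma state_indexK (n : nat) (p : 'I_(2 * n)) :
  state_index (block_index p) (entry_index p) = p.
Proof. by apply: val_inj; rewrite /= mulnC -divn_eq. Qed.

Lemma block_state_index (n : nat) (i : 'I_n) (c : 'I_2) :
  block_index (state_index i c) = i.
Proof. by apply: val_inj; rewrite /= mulnC divnMDl // divn_small ?addn0. Qed.

Lemma entry_state_index (n : nat) (i : 'I_n) (c : 'I_2) :
  entry_index (state_index i c) = c.
Proof. by apply: val_inj; rewrite /= mulnC modnMDl modn_small. Qed.

Lemma sum_state_index (V : nmodType) (n : nat) (F : 'I_(2 * n) -> V) :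
  \sum_p F p = \sum_(i < n) \sum_(c < 2) F (state_index i c).
Proof.
rewrite pair_bigA (reindex (fun u : 'I_n * 'I_2 => state_index u.1 u.2)) //=.
exists (fun p => (block_index p, entry_index p)) => [[i c] _ | p _] /=.
  by rewrite block_state_index entry_state_index.
exact: state_indexK.
Qed.

Lemma traffic_A_follower_row (R : realType) (r : road) (n : nat)
    (beta1 beta2 beta3 : 'I_n -> R) (i k : 'I_n) (c : 'I_2)
    (rho : 'cV[R[i]%C]_(2 * n)) :
  i = k.+1 :> nat ->
  (map_mx (real_complex R) (traffic_A r beta1 beta2 beta3) *m rho)
    (state_index i c) 0 =
  \sum_(d < 2) (real_complex R (A1 beta3 i c d) * rho (state_index k d) 0
              + real_complex R (A2 beta1 beta2 i c d) * rho (state_index i d) 0).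
Proof.
move=> ik; have neq_ki : k != i by rewrite -val_eqE /= ik neq_ltn ltnSn.
rewrite mxE sum_state_index (bigD1 k) //= (bigD1 i) 1?eq_sym //=.
rewrite [X in _ + (_ + X)]big1 ?addr0 => [|l /andP[l_k l_i]].
  rewrite -big_split; apply: eq_bigr => d _ /=.
  rewrite !mxE !block_state_index !entry_state_index /traffic_block ik /=.
  by rewrite !eqxx (negbTE neq_ki) (gtn_eqF (ltnSn k)) addr0 add0r !mxE.
apply: big1 => d _.
rewrite !mxE !block_state_index !entry_state_index /traffic_block ik /=.
by rewrite val_eqE (negbTE l_k) (negbTE l_i) addr0 mxE rmorph0 mul0r.
Qed.

(** * Propagation of zeros along the platoon *)

(** The hypotheses are the two rows of [A - lambda] at a vehicle whose
    predecessor is at rest. *)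
Lemma stable_follower (R : realType) (b1 b2 : R) (lambda s v : R[i]%C) :
  0 < b1 -> 0 < b2 -> 0 <= complex.Re lambda ->
  lambda * s = - v ->
  lambda * v = real_complex R b1 * s - real_complex R b2 * v ->
  s = 0 /\ v = 0.
Proof.
move=> b1_gt0 b2_gt0 lambda_ge0 eq_s eq_v.
have v_def : v = - (lambda * s) by rewrite eq_s opprK.
have /eqP : (lambda ^+ 2 + real_complex R b2 * lambda + real_complex R b1) * s
            = 0.
  rewrite v_def in eq_v.
  transitivity (real_complex R b1 * s - real_complex R b2 * (- (lambda * s))
                - lambda * (- (lambda * s))); first by ring.
  by rewrite eq_v subrr.
rewrite mulf_eq0 (negbTE (hurwitz_quadratic _ _ _ _ _ _ _)) //= => /eqP s0.
by rewrite v_def s0 mulr0 oppr0.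
Qed.

Lemma eigenvector_eq0 (R : realType) (r : road) (n : nat)
    (beta1 beta2 beta3 : 'I_n -> R) (lambda : R[i]%C)
    (rho : 'cV[R[i]%C]_(2 * n)) :
  (forall i : 'I_n, (0 < i)%N -> 0 < beta1 i /\ 0 < beta2 i) ->
  0 <= complex.Re lambda ->
  map_mx (real_complex R) (traffic_A r beta1 beta2 beta3) *m rho
    = lambda *: rho ->
  (forall (i : 'I_n) c, i = 0%N :> nat -> rho (state_index i c) 0 = 0) ->
  rho = 0.
Proof.
move=> beta_gt0 lambda_ge0 eig rho_first.
suff rho0 m (i : 'I_n) c : i = m :> nat -> rho (state_index i c) 0 = 0.
  by apply/colP => p; rewrite -[p]state_indexK (rho0 (block_index p)) // mxE.
elim: m i c => [|m IHm] i c im; first exact: rho_first.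
have m_lt : (m < n)%N by rewrite ltnW // -im.
pose k := Ordinal m_lt.
have row d := congr1 (fun u : 'cV_(2 * n) => u (state_index i d) 0) eig.
have row_s := row 0; have row_v := row 1.
rewrite (traffic_A_follower_row _ _ _ _ _ _ _ k) // !big_ord_recl big_ord0
  in row_s.
rewrite (traffic_A_follower_row _ _ _ _ _ _ _ k) // !big_ord_recl big_ord0
  in row_v.
rewrite !(IHm k) // !mxE /= !mulr0 !add0r !addr0 in row_s row_v.
have ord1E : lift ord0 ord0 = 1 :> 'I_2 by apply: val_inj.
rewrite rmorph0 mul0r add0r rmorphN rmorph1 mulN1r ord1E in row_s.
rewrite rmorphN mulNr ord1E in row_v.
have [b1_gt0 b2_gt0] : 0 < beta1 i /\ 0 < beta2 i by apply: beta_gt0; rewrite im.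
have [s0 v0] := stable_follower _ _ _ _ _ _ b1_gt0 b2_gt0 lambda_ge0
                  (esym row_s) (esym row_v).
by case: c => [[|[|//]] c_lt]; [rewrite -[RHS]s0 | rewrite -[RHS]v0];
  congr (rho _ _); apply: val_inj.
Qed.

(** * Detectability *)

Lemma measured_coord_eq0 (R : realType) (N q : nat) (C : 'M[R]_(q, N))
    (k : 'I_q) (p : 'I_N) (rho : 'cV[R[i]%C]_N) :
  row k C = delta_mx 0 p -> map_mx (real_complex R) C *m rho = 0 ->
  rho p 0 = 0.
Proof.
move=> Ck /(congr1 (row k)).
rewrite row_mul -map_row Ck map_delta_mx -rowE => /rowP /(_ 0).
by rewrite !mxE.
Qed.

(** Both output matrices of the theorem are instances: the measured vehicles
    enter only through the rows that read the automated one. *)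
Lemma detectable_first_measured (R : realType) (r : road) (n q : nat)
    (beta1 beta2 beta3 : 'I_n -> R) (C : 'M[R]_(q, 2 * n)) :
  (forall i : 'I_n, (0 < i)%N -> 0 < beta1 i /\ 0 < beta2 i) ->
  (forall (i : 'I_n) c, i = 0%N :> nat ->
     exists k, row k C = delta_mx 0 (state_index i c)) ->
  detectable (traffic_system r beta1 beta2 beta3 C).
Proof.
move=> beta_gt0 C_first lambda [rho [rho_neq0 eig unobs]].
rewrite ltNge; apply/negP => lambda_ge0; case/eqP: rho_neq0.
apply: eigenvector_eq0 beta_gt0 lambda_ge0 eig _ => i c /(C_first i c)[k Ck].
exact: measured_coord_eq0 Ck unobs.
Qed.

Theorem theorem2 (R : realType) (r : road) (n : nat) (hn : (2 <= n)%N)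
    (beta1 beta2 beta3 : 'I_n -> R)
    (hbeta : forall i : 'I_n, (0 < i)%N ->
       [/\ 0 < beta1 i, 0 < beta2 i & 0 < beta3 i]) :
  (forall (m : nat) (hm : (0 < m)%N) (j : 'I_m -> 'I_n),
     j (Ordinal hm) = 0%N :> nat ->
     detectable (traffic_system r beta1 beta2 beta3 (measure_C R j)))
  /\ detectable (traffic_system r beta1 beta2 beta3 (measure_first_C R n)).
Proof.
have beta_gt0 (i : 'I_n) : (0 < i)%N -> 0 < beta1 i /\ 0 < beta2 i.
  by move=> /hbeta[].
split=> [m hm j j0|]; apply: detectable_first_measured => // i c i0.
  exists (state_index (Ordinal hm) c).
  rewrite rowK block_state_index entry_state_index.
  by congr (delta_mx 0 (state_index _ c)); apply: val_inj; rewrite /= j0 i0.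
exists c; apply/rowP => p; rewrite !mxE eqxx /= -val_eqE /=.
by rewrite i0 muln0 add0n.
Qed.
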